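(* For $n\geqslant 1$, define $$B_n(x,y,s,t,p,q)=\sum_{\sigma\in\mathcal{S}^B_n}x^{\mathrm{exc}(\sigma)}y^{\mathrm{aexc}(\sigma)}s^{\mathrm{single}(\sigma)}t^{\mathrm{fix}(\sigma)}p^{\mathrm{neg}(\sigma)}q^{\mathrm{cyc}(\sigma)}$$ and $A_n(x,p,q)=\sum_{\pi\in\mathcal{S}_n}x^{\mathrm{exc}(\pi)}p^{\mathrm{fix}(\pi)}q^{\mathrm{cyc}(\pi)}$. Then $$B_n(x,y,s,t,p,q)=(1+p)^ny^nA_n\left(\frac{x}{y},\frac{t+sp}{(1+p)y},q\right).$$
   Context: $\mathcal{S}^B_n$ is the hyperoctahedral group: bijections $\sigma$ of $\pm[n]=\{\pm1,\dots,\pm n\}$ with $\sigma(-i)=-\sigma(i)$, written $\sigma=\sigma(1)\cdots\sigma(n)$. For $\sigma\in\mathcal{S}^B_n$ and $i\in[n]$: $i$ is an excedance if $\sigma(|\sigma(i)|)>\sigma(i)$, an anti-excedance if $\sigma(|\sigma(i)|)<\sigma(i)$, a fixed point if $\sigma(i)=i$, a singleton if $\sigma(i)=-i$; $\mathrm{exc},\mathrm{aexc},\mathrm{fix},\mathrm{single}$ count these, $\mathrm{neg}(\sigma)=\#\{i\in[n]:\sigma(i)<0\}$, and $\mathrm{cyc}(\sigma)$ is the number of cycles of the permutation $i\mapsto|\sigma(i)|$ of $[n]$. For $\pi\in\mathcal{S}_n$: $\mathrm{exc}(\pi)=\#\{i:\pi(i)>i\}$, $\mathrm{fix}(\pi)=\#\{i:\pi(i)=i\}$,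 $\mathrm{cyc}(\pi)$ the number of cycles. The right-hand side is a polynomial since each monomial of $A_n$ has total $x$- and $p$-degree at most $n$. *)

(* Defs.v *)
From HB Require Import structures.
From mathcomp Require Import all_boot all_order all_algebra all_fingroup.
From mathcomp Require Import mpoly.

Set Implicit Arguments.
Unset Strict Implicit.
Unset Printing Implicit Defensive.

Import Order.TTheory GRing.Theory Num.Theory.

Local Open Scope ring_scope.

(* The integer k in {1, ..., n} is represented throughout by the ordinal k - 1
   of 'I_n. An element (i, b) of pm n stands for the integer i + 1 of +-[n] when
   b is false, and for -(i + 1) when b is true. *)
Definition pm (n : nat) : finType := ('I_n * bool)%type.

Section Signed.

Variable n : nat.

Definition pmval (a : pm n) : int := if a.2 then - a.1.+1%:Z else a.1.+1%:Z.
Definition pmpos (i : 'I_n) : pm n := (i, false).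
Definition pmopp (a : pm n) : pm n := (a.1, ~~ a.2).
Definition pmabs (a : pm n) : 'I_n := a.1.

Definition is_signed (sigma : {perm (pm n)}) : bool :=
  [forall a, sigma (pmopp a) == pmopp (sigma a)].

Definition signed_perm := {sigma : {perm (pm n)} | is_signed sigma}.

Implicit Type sigma : signed_perm.

Definition sp_app sigma (i : 'I_n) : pm n := val sigma (pmpos i).

Definition abs_fun sigma (i : 'I_n) : 'I_n := pmabs (sp_app sigma i).

Lemma abs_fun_inj sigma : injective (abs_fun sigma).
Proof.
move=> i j; rewrite /abs_fun /sp_app /pmabs => eq_ij.
case: sigma eq_ij => s /= /forallP s_signed eq_ij.
have [eq_b | neq_b] := eqVneq (s (pmpos i)).2 (s (pmpos j)).2.
  have: s (pmpos i) = s (pmpos j).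
    by rewrite [LHS]surjective_pairing eq_ij eq_b -surjective_pairing.
  by move/perm_inj=> [].
have: s (pmpos i) = s (pmopp (pmpos j)).
  rewrite (eqP (s_signed _)) /pmopp -eq_ij [LHS]surjective_pairing.
  by congr pair; move: neq_b; do 2!case: (_.2).
by move/perm_inj=> [].
Qed.

Definition abs_perm sigma : {perm 'I_n} := perm (@abs_fun_inj sigma).

Definition excB sigma : nat :=
  #|[set i : 'I_n |
      pmval (sp_app sigma (pmabs (sp_app sigma i))) > pmval (sp_app sigma i)]|.
Definition aexcB sigma : nat :=
  #|[set i : 'I_n |
      pmval (sp_app sigma (pmabs (sp_app sigma i))) < pmval (sp_app sigma i)]|.
Definition fixB sigma : nat := #|[set i : 'I_n | sp_app sigma i == pmpos i]|.
Definition singleB sigma : nat :=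
  #|[set i : 'I_n | sp_app sigma i == pmopp (pmpos i)]|.
Definition negB sigma : nat := #|[set i : 'I_n | pmval (sp_app sigma i) < 0]|.
Definition cycB sigma : nat := #|porbits (abs_perm sigma)|.

Implicit Type pi : {perm 'I_n}.

Definition excA pi : nat := #|[set i : 'I_n | (i < pi i)%N]|.
Definition fixA pi : nat := #|[set i : 'I_n | pi i == i]|.
Definition cycA pi : nat := #|porbits pi|.

(* The variables 'X_0, 'X_1, 'X_2 are x, p, q. *)
Definition A_poly : {mpoly int[3]} :=
  let x := 'X_(@Ordinal 3 0 isT) in
  let p := 'X_(@Ordinal 3 1 isT) in
  let q := 'X_(@Ordinal 3 2 isT) in
  \sum_(pi : {perm 'I_n}) x ^+ excA pi * p ^+ fixA pi * q ^+ cycA pi.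

End Signed.

Definition varx : {mpoly int[6]} := 'X_(@Ordinal 6 0 isT).
Definition vary : {mpoly int[6]} := 'X_(@Ordinal 6 1 isT).
Definition vars : {mpoly int[6]} := 'X_(@Ordinal 6 2 isT).
Definition vart : {mpoly int[6]} := 'X_(@Ordinal 6 3 isT).
Definition varp : {mpoly int[6]} := 'X_(@Ordinal 6 4 isT).
Definition varq : {mpoly int[6]} := 'X_(@Ordinal 6 5 isT).

Definition B_poly (n : nat) : {mpoly int[6]} :=
  \sum_(sigma : signed_perm n)
     varx ^+ excB sigma * vary ^+ aexcB sigma * vars ^+ singleB sigma *
     vart ^+ fixB sigma * varp ^+ negB sigma * varq ^+ cycB sigma.

(* The value of A_n at elements a, b, c of a commutative ring. *)
Definition A_eval (K : comNzRingType) (n : nat) (a b c : K) : K :=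
  mmap intr (tnth [tuple a; b; c]) (A_poly n).

(* Main.v *)
(* Write sigma(i) = delta(pi(i)) pi(i), with pi = |sigma| and signs delta indexed
   by values. Putting v(j) = delta(j) j, i is an excedance of sigma iff
   v(pi(j)) > v(j) for j = pi(i): the excedances of sigma are those of pi for the
   linear order that v induces on [n]. For a given fixed point set F of pi, the
   joint distribution of excedances and cycles does not depend on this order:
   conjugate by the permutation that is the identity on F and the increasing
   bijection off F. Hence delta can be summed separately, which yields a factor
   t + s p for each fixed point and 1 + p for each other point. *)
Require Import Defs.
From HB Require Import structures.
From mathcomp Require Import all_boot all_order all_algebra all_fingroup.
From mathcomp Require Import mpoly.
From mathcomp Require Import ring.

Set Implicit Arguments.
Unset Strict Implicit.
Unset Printing Implicit Defensive.

Import Order.TTheory GRing.Theory Num.Theory.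

Local Open Scope ring_scope.

(** * Matching two linear orders on a subset *)

Lemma perm_on_order_iso (T : finType) (d1 d2 : Order.disp_t)
    (U : orderType d1) (V : orderType d2) (u : T -> U) (v : T -> V)
    (A : {set T}) :
  injective u -> injective v ->
  exists2 rho : {perm T}, perm_on A rho &
    {in A &, forall i j, (v (rho i) < v (rho j))%O = (u i < u j)%O}.
Proof.
move=> u_inj v_inj.
(* [sa] lists [A] by increasing label. The permutation sends the [k]-th entry of the list for [u] to
   the [k]-th entry of the list for [v], and fixes every point outside [A]. *)
pose sa d (W : orderType d) (w : T -> W) := sort (relpre w <=%O) (enum A).
have sa_mem d (W : orderType d) (w : T -> W) i : (i \in sa d W w) = (i \in A).
  by rewrite mem_sort mem_enum.
have sa_uniq d (W : orderType d) (w : T -> W) : uniq (sa d W w).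
  by rewrite sort_uniq enum_uniq.
have sa_size d (W : orderType d) (w : T -> W) : size (sa d W w) = #|A|.
  by rewrite size_sort cardE.
have sa_lt d (W : orderType d) (w : T -> W) : injective w ->
    {in A &, forall i j,
       (w i < w j)%O = (index i (sa d W w) < index j (sa d W w))%N}.
  move=> w_inj i j Ai Aj.
  have sorted_w : sorted <%O (map w (sa d W w)).
    by rewrite -sort_map sort_lt_sorted map_inj_uniq ?enum_uniq.
  have idx k : k \in A -> index k (sa d W w) \in
      [pred m | (m < size (map w (sa d W w)))%N].
    by move=> Ak; rewrite inE size_map index_mem sa_mem.
  rewrite -(lt_sorted_ltn_nth (w i) sorted_w) ?idx //.
  by rewrite !(nth_map i) ?index_mem ?sa_mem // !nth_index ?sa_mem.
pose f i := if i \in A then nth i (sa _ _ v) (index i (sa _ _ u)) else i.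
have idx_lt i : i \in A -> (index i (sa _ _ u) < size (sa _ _ v))%N.
  by move=> Ai; rewrite sa_size -(sa_size _ _ u) index_mem sa_mem.
have fA i : (f i \in A) = (i \in A).
  rewrite /f; case: ifP => // Ai.
  by rewrite -(sa_mem _ _ v) mem_nth ?idx_lt.
have f_index i : i \in A -> index (f i) (sa _ _ v) = index i (sa _ _ u).
  by move=> Ai; rewrite /f Ai index_uniq ?idx_lt.
have f_inj : injective f.
  move=> i j eq_f; have := fA j; rewrite -eq_f fA.
  case Ai: (i \in A) => Aj; last by move: eq_f; rewrite /f Ai -Aj.
  have := f_index i Ai; rewrite eq_f f_index // => /esym.
  by apply: index_inj; rewrite ?sa_mem.
exists (perm f_inj).
  by apply/subsetP => i; rewrite inE permE /f; case: ifP; rewrite ?eqxx.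
by move=> i j Ai Aj; rewrite !permE !sa_lt ?fA // !f_index.
Qed.

(** * Cycles under conjugation *)

Lemma porbitJ (T : finType) (s t : {perm T}) (x : T) :
  porbit (s ^ t)%g (t x) = t @: porbit s x.
Proof.
apply/setP => y; apply/porbitP/imsetP => [[i ->] | [z /porbitP[i ->] ->]].
  by exists ((s ^+ i)%g x); rewrite ?mem_porbit // -conjXg permJ.
by exists i; rewrite -conjXg permJ.
Qed.

Lemma card_porbitsJ (T : finType) (s t : {perm T}) :
  #|porbits (s ^ t)%g| = #|porbits s|.
Proof.
rewrite -[RHS](card_imset _ (imset_inj (@perm_inj _ t))).
congr #|pred_of_set _|; apply/setP => B; apply/imsetP/imsetP.
  case=> x _ ->; exists (porbit s (t^-1%g x)); first exact: imset_f.
  by rewrite -porbitJ permKV.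
by case=> _ /imsetP[x _ ->] ->; exists (t x); rewrite ?porbitJ.
Qed.

(** * Excedances with respect to an arbitrary linear order *)

Definition fix_set (T : finType) (pi : {perm T}) : {set T} :=
  [set i | pi i == i].

(** With [u] the identity of ['I_n] this unfolds to [excA]. *)
Definition exc_wrt (T : finType) (d : Order.disp_t) (U : orderType d)
    (u : T -> U) (pi : {perm T}) : nat := #|[set i | (u i < u (pi i))%O]|.

(** Trichotomy at each point: since [u] is injective, equal labels mean a fixed point. The
    anti-excedances are thus determined by the two other counts. *)
Lemma exc_fix_wrt (T : finType) (d : Order.disp_t) (U : orderType d)
    (u : T -> U) (pi : {perm T}) : injective u ->
  (#|[set i | (u (pi i) < u i)%O]| + #|fix_set pi| + exc_wrt u pi = #|T|)%N.
Proof.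
move=> u_inj; rewrite /exc_wrt -!sum1_card !(big_mkcond (fun i => i \in pred_of_set _)).
rewrite -!big_split /=; apply: eq_bigr => i _; rewrite !inE -(inj_eq u_inj).
by case: (ltgtP (u (pi i)) (u i)).
Qed.

Section Conjugation.

Variables (T : finType) (d1 d2 : Order.disp_t).
Variables (U : orderType d1) (V : orderType d2) (u : T -> U) (v : T -> V).
Hypotheses (u_inj : injective u) (v_inj : injective v).

(** Monotonicity off the fixed points suffices: a fixed point is never an excedance, and [pi i] is
    not fixed when [i] is not. *)
Lemma exc_wrtJ (pi rho : {perm T}) :
    {in ~: fix_set pi &,
       forall i j, (v (rho i) < v (rho j))%O = (u i < u j)%O} ->
  exc_wrt v (pi ^ rho)%g = exc_wrt u pi.
Proof.
move=> rho_lt; rewrite /exc_wrt -[RHS](card_imset _ (@perm_inj _ rho)).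
congr #|pred_of_set _|; apply/setP => j; rewrite -[j](permKV rho).
move: (_ j) => i; rewrite mem_imset ?inE ?permJ; last exact: perm_inj.
have [pi_i | pi_i] := eqVneq (pi i) i; first by rewrite pi_i !ltxx.
by rewrite rho_lt ?inE // (inj_eq perm_inj).
Qed.

Lemma fix_setJ (pi rho : {perm T}) : fix_set (pi ^ rho)%g = rho @: fix_set pi.
Proof.
apply/setP => j; rewrite -[j](permKV rho); move: (_ j) => i.
by rewrite mem_imset ?inE ?permJ ?(inj_eq perm_inj) //; apply: perm_inj.
Qed.

(** The arbitrary [h] expresses equality of joint distributions. Conjugation by [rho] permutes the
    index set because [rho] maps [F] onto itself. *)
Lemma sum_exc_cyc_fix_set (M : nmodType) (h : nat -> nat -> M) (F : {set T}) :
  \sum_(pi : {perm T} | fix_set pi == F) h (exc_wrt u pi) #|porbits pi| =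
  \sum_(pi : {perm T} | fix_set pi == F) h (exc_wrt v pi) #|porbits pi|.
Proof.
have [rho rho_on rho_lt] := perm_on_order_iso (~: F) u_inj v_inj.
have rhoF : rho @: F = F.
  rewrite -[RHS]imset_id; apply: eq_in_imset => i Fi.
  by rewrite (out_perm rho_on) // inE Fi.
rewrite [RHS](reindex_inj (conjg_inj rho)) /=.
apply: eq_big => [pi | pi /eqP F_pi]; last first.
  by rewrite card_porbitsJ exc_wrtJ // F_pi.
by rewrite fix_setJ -{2}rhoF (inj_eq (imset_inj perm_inj)).
Qed.

End Conjugation.

(** * Signed permutations as pairs of a permutation and signs *)

Section SignedPermutations.

Variable n : nat.

(** The sign of the argument enters by exclusive or, so that the map commutes with [pmopp]. *)
Lemma signed_fun_inj (pi : {perm 'I_n}) (delta : {ffun 'I_n -> bool}) :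
  injective (fun a : pm n => (pi a.1, a.2 (+) delta (pi a.1)) : pm n).
Proof.
by case=> i b [j c] /= [/perm_inj <- /(can_inj (addbK _)) <-].
Qed.

Lemma signed_fun_signed pi delta :
  is_signed (perm (@signed_fun_inj pi delta)).
Proof. by apply/forallP => a; rewrite !permE /pmopp /= addNb. Qed.

(* The signs are indexed by values, not by positions: [delta j] is the sign of
   the entry of absolute value [j]. *)
Definition sperm_of (w : {perm 'I_n} * {ffun 'I_n -> bool}) : signed_perm n :=
  exist (@is_signed n) _ (signed_fun_signed w.1 w.2).

Lemma sp_app_of pi delta i :
  sp_app (sperm_of (pi, delta)) i = (pi i, delta (pi i)).
Proof. by rewrite /sp_app /= permE. Qed.

Lemma abs_perm_of pi delta : abs_perm (sperm_of (pi, delta)) = pi.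
Proof. by apply/permP => i; rewrite permE /abs_fun sp_app_of. Qed.

Lemma sp_app_inj (sigma tau : signed_perm n) :
  sp_app sigma =1 sp_app tau -> sigma = tau.
Proof.
move=> eq_app; apply/val_inj/permP => -[i []]; last exact: eq_app.
have oppE (rho : signed_perm n) : val rho (i, true) = pmopp (sp_app rho i).
  by have /forallP/(_ (pmpos i))/eqP := valP rho.
by rewrite !oppE eq_app.
Qed.

Lemma sperm_of_bij : bijective sperm_of.
Proof.
(* The sign of the value [j] is read at the position where [j] occurs, its preimage under
   [abs_perm sigma]. *)
exists (fun sigma => (abs_perm sigma,
   [ffun j => (sp_app sigma ((abs_perm sigma)^-1%g j)).2])) => [[pi delta]|sigma].
  rewrite abs_perm_of; congr pair; apply/ffunP => j.
  by rewrite ffunE sp_app_of /= permKV.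
apply: sp_app_inj => i; rewrite sp_app_of ffunE permK permE.
by rewrite /abs_fun -surjective_pairing.
Qed.

Definition sval_of (delta : 'I_n -> bool) (j : 'I_n) : int :=
  pmval (j, delta j).

Lemma sval_of_inj delta : injective (sval_of delta).
Proof.
move=> i j; rewrite /sval_of /pmval /= => eq_ij; apply/val_inj/eqP.
by case: (delta i) (delta j) eq_ij => [] [] //= [->].
Qed.

(** The condition at position [i] compares the labels of [pi i] and [pi (pi i)], so the set on the
    left is the preimage under [pi] of the set on the right. *)
Lemma excB_of pi delta :
  excB (sperm_of (pi, delta)) = exc_wrt (sval_of delta) pi.
Proof.
rewrite /excB /exc_wrt -[RHS](card_preimset _ (@perm_inj _ pi)).
by apply: eq_card => i; rewrite !inE !sp_app_of.
Qed.

Lemma aexcB_of pi delta :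
  aexcB (sperm_of (pi, delta)) =
  #|[set i | sval_of delta (pi i) < sval_of delta i]|.
Proof.
rewrite /aexcB -[RHS](card_preimset _ (@perm_inj _ pi)).
by apply: eq_card => i; rewrite !inE !sp_app_of.
Qed.

Lemma fixB_of pi delta :
  fixB (sperm_of (pi, delta)) = #|[set i in fix_set pi | ~~ delta i]|.
Proof.
apply: eq_card => i; rewrite !inE sp_app_of xpair_eqE.
by have [->|] := eqVneq (pi i) i; case: (delta i).
Qed.

Lemma singleB_of pi delta :
  singleB (sperm_of (pi, delta)) = #|[set i in fix_set pi | delta i]|.
Proof.
apply: eq_card => i; rewrite !inE sp_app_of xpair_eqE.
by have [->|] := eqVneq (pi i) i; case: (delta i).
Qed.

Lemma negB_of pi delta : negB (sperm_of (pi, delta)) = #|[set j | delta j]|.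
Proof.
rewrite /negB -[RHS](card_preimset _ (@perm_inj _ pi)).
by apply: eq_card => i; rewrite !inE sp_app_of /pmval /=; case: (delta _).
Qed.

(** The signs are independent, so the sum factors over the points of ['I_n]. *)
Lemma sum_signs (R : comNzRingType) (s t p : R) (F : {set 'I_n}) :
  \sum_(delta : {ffun 'I_n -> bool})
     s ^+ #|[set i in F | delta i]| * t ^+ #|[set i in F | ~~ delta i]| *
     p ^+ #|[set i | delta i]| =
  (t + s * p) ^+ #|F| * (1 + p) ^+ (n - #|F|).
Proof.
(* [w i b] is the factor due to the sign [b] at [i]: a negative sign in [F] gives both a singleton
   and a negative entry, one outside [F] only a negative entry. *)
pose w i (b : bool) := if i \in F then if b then s * p else t else p ^+ b.
have -> : (t + s * p) ^+ #|F| * (1 + p) ^+ (n - #|F|) = \prod_i \sum_b w i b.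
  have -> : (n - #|F|)%N = #|~: F| by rewrite [RHS]cardsCs setCK card_ord.
  rewrite -!prodr_const.
  rewrite !(big_mkcond (fun i => i \in pred_of_set _)) -big_split; apply: eq_bigr => i _ /=.
  by rewrite big_bool /w inE; case: ifP; rewrite /= ?mul1r ?mulr1 addrC.
rewrite bigA_distr_bigA; apply: eq_bigr => delta _; rewrite -!prodr_const.
rewrite !(big_mkcond (fun i => i \in pred_of_set _)) -!big_split; apply: eq_bigr => i _ /=.
by rewrite /w !inE; case: (i \in F) (delta i) => [] [] /=;
  rewrite ?mulr1 ?mul1r.
Qed.

(** The division-free form of the theorem, with [n - excA pi - fixA pi] as the number of
    anti-excedances. *)
Lemma sum_signed_perm (R : comNzRingType) (x y s t p q : R) :
  \sum_(sigma : signed_perm n)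
     x ^+ excB sigma * y ^+ aexcB sigma * s ^+ singleB sigma *
     t ^+ fixB sigma * p ^+ negB sigma * q ^+ cycB sigma =
  \sum_(pi : {perm 'I_n})
     x ^+ excA pi * y ^+ (n - excA pi - fixA pi) * q ^+ cycA pi *
     ((t + s * p) ^+ fixA pi * (1 + p) ^+ (n - fixA pi)).
Proof.
pose h (F : {set 'I_n}) e c : R := x ^+ e * y ^+ (n - e - #|F|) * q ^+ c.
pose g (F : {set 'I_n}) (delta : {ffun 'I_n -> bool}) : R :=
  s ^+ #|[set i in F | delta i]| * t ^+ #|[set i in F | ~~ delta i]| *
  p ^+ #|[set i | delta i]|.
rewrite (reindex sperm_of) /=; last exact/onW_bij/sperm_of_bij.
transitivity (\sum_(pi : {perm 'I_n}) \sum_(delta : {ffun 'I_n -> bool})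
    h (fix_set pi) (exc_wrt (sval_of delta) pi) #|porbits pi| *
    g (fix_set pi) delta).
  rewrite pair_bigA; apply: eq_bigr => -[pi delta] _ /=.
  rewrite excB_of aexcB_of singleB_of fixB_of negB_of /cycB abs_perm_of /h /g.
  have <- : #|[set i | sval_of delta (pi i) < sval_of delta i]| =
      (n - exc_wrt (sval_of delta) pi - #|fix_set pi|)%N.
    have := exc_fix_wrt pi (@sval_of_inj delta); rewrite card_ord.
    by move/(canRL (addnK _))/(canRL (addnK _)).
  rewrite -!mulrA; congr (_ * (_ * _)).
  by rewrite !mulrA mulrC !mulrA.
(* With [delta] frozen, the order given by [sval_of delta] is a fixed linear order and can be
   replaced by the usual one. *)
rewrite exchange_big /=.
transitivity (\sum_(delta : {ffun 'I_n -> bool}) \sum_(pi : {perm 'I_n})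
    h (fix_set pi) (excA pi) #|porbits pi| * g (fix_set pi) delta).
  apply: eq_bigr => delta _.
  rewrite (partition_big (@fix_set _) predT) //=.
  rewrite [RHS](partition_big (@fix_set _) predT) //=.
  apply: eq_bigr => F _.
  transitivity (\sum_(pi : {perm 'I_n} | fix_set pi == F)
      h F (exc_wrt (sval_of delta) pi) #|porbits pi| * g F delta).
    by apply: eq_bigr => pi /eqP ->.
  (* Once [F] is fixed, [g F delta] is constant in [pi] and is absorbed into the weight. *)
  rewrite (sum_exc_cyc_fix_set (@sval_of_inj delta) (v := @id 'I_n) (@inj_id _)
    (fun e c => h F e c * g F delta)).
  by apply: eq_bigr => pi /eqP ->.
rewrite exchange_big /=; apply: eq_bigr => pi _.
by rewrite -big_distrr /= sum_signs.
Qed.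

End SignedPermutations.

(** * Evaluation of [A_poly] and passage to fractions *)

Lemma A_evalE (K : comNzRingType) (n : nat) (a b c : K) :
  A_eval n a b c = \sum_(pi : {perm 'I_n})
    a ^+ excA pi * b ^+ fixA pi * c ^+ cycA pi.
Proof.
pose f : {rmorphism {mpoly int[3]} -> K} :=
  mmap (intr : {rmorphism int -> K}) (tnth [tuple a; b; c]).
rewrite -[LHS]/(f (A_poly n)) rmorph_sum; apply: eq_bigr => pi _.
by rewrite !rmorphM !rmorphXn /= !mmapX !mmap1U.
Qed.

Lemma weight_rescale (K : fieldType) (x y u r z : K) (n e f : nat) :
    y != 0 -> r != 0 -> (e + f <= n)%N ->
  x ^+ e * y ^+ (n - e - f) * z * (u ^+ f * r ^+ (n - f)) =
  r ^+ n * y ^+ n * ((x / y) ^+ e * (u / (r * y)) ^+ f * z).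
Proof.
(* Writing [n] as [m + (e + f)] removes the truncated subtractions. *)
move=> y_neq0 r_neq0 /subnK <-; move: (n - _)%N => m.
have -> : (m + (e + f) - e - f = m)%N by rewrite -subnDA addnK.
rewrite addnA addnK !exprD !expr_div_n exprMn.
(* The powers to be cancelled become nonzero atoms, so that [field] meets no symbolic exponent in a
   denominator. *)
have := (expf_neq0 e y_neq0, expf_neq0 f y_neq0, expf_neq0 f r_neq0).
move: (y ^+ e) (y ^+ f) (r ^+ f) => ye yf rf [[ye_neq0 yf_neq0] rf_neq0].
by field; rewrite yf_neq0 rf_neq0.
Qed.

Theorem theorem24 (n : nat) (n_ge1 : (1 <= n)%N) :
  let K : fieldType := {fraction {mpoly int[6]}} in
  let x : K := tofrac varx in
  let y : K := tofrac vary in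
  let s : K := tofrac vars in
  let t : K := tofrac vart in
  let p : K := tofrac varp in
  let q : K := tofrac varq in
  tofrac (B_poly n) =
    (1 + p) ^+ n * y ^+ n * A_eval n (x / y) ((t + s * p) / ((1 + p) * y)) q.
Proof.
move=> K x y s t p q.
(* Setting all variables to 1 turns [vary] into 1 and [1 + varp] into 2, so neither polynomial is
   zero. *)
have y_neq0 : y != 0.
  rewrite tofrac_eq0; apply/eqP => /(congr1 (meval (fun=> 1))).
  by rewrite mevalXU meval0.
have p1_neq0 : 1 + p != 0.
  rewrite -(tofrac1 _) -tofracD tofrac_eq0.
  apply/eqP => /(congr1 (meval (fun=> 1))).
  by rewrite mevalD meval1 mevalXU meval0.
(* The division-free identity is applied among polynomials, before the embedding into fractions is
   distributed over the sum. *)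
rewrite A_evalE /B_poly sum_signed_perm rmorph_sum mulr_sumr.
apply: eq_bigr => pi _.
have le_n : (excA pi + fixA pi <= n)%N.
  have := exc_fix_wrt pi (u := @id 'I_n) (@inj_id _); rewrite card_ord => sizeE.
  by rewrite (leq_trans _ (eq_leq sizeE)) // addnC leq_add2r leq_addl.
rewrite !rmorphM /= !rmorphXn /= !rmorphD !rmorphM rmorph1 /=.
by rewrite -/x -/y -/s -/t -/p -/q weight_rescale.
Qed.
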